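(* Let $p,q\in\mathbb N$ with $q>p$, let $\mathcal F\colon\mathbb R^p\to\mathbb R^q$ and $D_N\mathcal F\colon\mathbb R^p\to\mathbb R^{q\times p}$ be given mappings, and let $M\subset\mathbb R^p$ be a set such that some solution $\bar z\in\mathbb R^p$ of $\mathcal F(z)=0$ satisfies $\bar z\in M$. Assume that $\mathcal F$ is Newton-differentiable on $M$ with Newton-derivative $D_N\mathcal F$. Assume that there are $\delta>0$ and $C>0$ such that, for all $z\in\mathbb B_\delta(\bar z)$, the matrix $D_N\mathcal F(z)$ possesses full column rank $p$ and $$\lambda_{\min}\bigl(D_N\mathcal F(z)^\top D_N\mathcal F(z)\bigr)\ge\frac1C,\qquad \|D_N\mathcal F(z)\|\le C.$$ Then there exists $\varepsilon>0$ such that, for each starting point $z^0\in\mathbb B_\varepsilon(\bar z)$ and each null sequence $\{\nu_k\}\subset(0,\varepsilon)$, the local nonsmooth Levenberg--Marquardt method (see context) terminates after finitely many steps or produces a sequence $\{z^k\}$ which converges to $\bar z$ superlinearly. Furthermore, if $\mathcal F$ is even Newton-differentiable on $M$ of order $1$ with Newton-derivative $D_N\mathcal F$, if $\nu_k\in O(\|\mathcal F(z^k)\|)$ as $k\to\infty$, and if $\mathcal F$ is calm at $\bar z$, then the convergence is quadratic.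
   Context: Norms are Euclidean norms for vectors and spectral norms for matrices; $\mathbb B_\varepsilon(x)$ is the closed $\varepsilon$-ball around $x$; $\lambda_{\min}(N)$ is the smallest eigenvalue of a symmetric matrix $N$; $\mathbb I^p$ is the $p\times p$ identity matrix. Newton-differentiability: Given $\mathcal F\colon\mathbb R^p\to\mathbb R^q$, $D_N\mathcal F\colon\mathbb R^p\to\mathbb R^{q\times p}$, and a nonempty set $M\subset\mathbb R^p$, $\mathcal F$ is Newton-differentiable on $M$ with Newton-derivative $D_N\mathcal F$ if for each $z\in M$, $\mathcal F(z+d)-\mathcal F(z)-D_N\mathcal F(z+d)d=o(\|d\|)$ as $d\to0$. It is Newton-differentiable on $M$ of order $\alpha\in(0,1]$ if for each $z\in M$ the left-hand side is $O(\|d\|^{1+\alpha})$. $\mathcal F$ is calm at $\bar z$ if there are $L>0$ and $\epsilon>0$ with $\|\mathcal F(z)-\mathcal F(\bar z)\|\le L\|z-\bar z\|$ for all $z\in\mathbb B_{\epsilon}(\bar z)$. Local nonsmooth Levenberg--Marquardt method: starting from $z^0\in\mathbb R^p$, as long as a suitable (unspecified) termination criterion is violated at iteration $k$, take $\nu_k>0$, let $d^k$ be the unique solution $d$ of $$\bigl(D_N\mathcal F(z^k)^\top D_N\mathcal F(z^k)+\nu_k\mathbb I^p\bigr)d=-D_N\mathcal F(z^k)^\top\mathcal F(z^k),$$ set $z^{k+1}:=z^k+d^k$, and continue with $k+1$. Convergence $z^k\to\bar z$ is superlinear if $\|z^{k+1}-\bar z\|\in o(\|z^k-\bar z\|)$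 and quadratic if $\|z^{k+1}-\bar z\|\in O(\|z^k-\bar z\|^2)$. *)

(* Defs.v *)
From HB Require Import structures.
From mathcomp Require Import all_boot all_order all_algebra.
From mathcomp Require Import all_classical all_reals all_analysis.

Set Implicit Arguments.
Unset Strict Implicit.
Unset Printing Implicit Defensive.

Import Order.TTheory GRing.Theory Num.Theory.
Import numFieldNormedType.Exports.

Local Open Scope classical_set_scope.
Local Open Scope ring_scope.

(* The norm `|x| of the library on 'cV[R]_n is the maximum norm. It induces
   the same topology on 'cV[R]_n, so the library's neighbourhood filters can
   be used together with enorm. *)
Definition enorm (R : realType) (n : nat) (x : 'cV[R]_n) : R :=
  Num.sqrt (\sum_(i < n) x i 0 ^+ 2).

Definition eball (R : realType) (n : nat) (x : 'cV[R]_n) (e : R) :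
    set 'cV[R]_n :=
  [set y | enorm (y - x) <= e].

(* The matrix norm induced by the Euclidean norms. *)
Definition spectral_norm (R : realType) (m n : nat) (A : 'M[R]_(m, n)) : R :=
  sup [set enorm (A *m x) | x in [set x : 'cV[R]_n | enorm x <= 1]].

(* A symmetric N with n > 0 has a nonempty finite spectrum, so that the
   infimum is a minimum. *)
Definition lambda_min (R : realType) (n : nat) (N : 'M[R]_n) : R :=
  inf [set a | eigenvalue N a].

Definition newton_remainder (R : realType) (p q : nat)
    (F : 'cV[R]_p -> 'cV[R]_q) (DF : 'cV[R]_p -> 'M[R]_(q, p))
    (z d : 'cV[R]_p) : 'cV[R]_q :=
  F (z + d) - F z - DF (z + d) *m d.

Definition newton_differentiable (R : realType) (p q : nat)
    (F : 'cV[R]_p -> 'cV[R]_q) (DF : 'cV[R]_p -> 'M[R]_(q, p))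
    (M : set 'cV[R]_p) : Prop :=
  forall z, M z ->
    (fun d => enorm (newton_remainder F DF z d))
      =o_ (0 : 'cV[R]_p) (fun d : 'cV[R]_p => enorm d).

Definition newton_differentiable_order (R : realType) (p q : nat) (alpha : R)
    (F : 'cV[R]_p -> 'cV[R]_q) (DF : 'cV[R]_p -> 'M[R]_(q, p))
    (M : set 'cV[R]_p) : Prop :=
  forall z, M z ->
    (fun d => enorm (newton_remainder F DF z d))
      =O_ (0 : 'cV[R]_p) (fun d : 'cV[R]_p => enorm d `^ (1 + alpha)).

Definition calm_at (R : realType) (p q : nat)
    (F : 'cV[R]_p -> 'cV[R]_q) (zbar : 'cV[R]_p) : Prop :=
  exists L eps : R, [/\ 0 < L, 0 < eps &
    forall z, eball zbar eps z -> enorm (F z - F zbar) <= L * enorm (z - zbar)].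

Definition lm_direction (R : realType) (p q : nat)
    (F : 'cV[R]_p -> 'cV[R]_q) (DF : 'cV[R]_p -> 'M[R]_(q, p))
    (nu : R) (z d : 'cV[R]_p) : Prop :=
  unique (fun d : 'cV[R]_p =>
    ((DF z)^T *m DF z + nu%:M) *m d = - ((DF z)^T *m F z)) d.

(* stop k z holds when the termination criterion is satisfied at iteration k
   with current iterate z. *)
Definition lm_iteration (R : realType) (p q : nat)
    (F : 'cV[R]_p -> 'cV[R]_q) (DF : 'cV[R]_p -> 'M[R]_(q, p))
    (stop : nat -> 'cV[R]_p -> Prop) (nu : nat -> R)
    (z : nat -> 'cV[R]_p) (k : nat) : Prop :=
  ~ stop k (z k) /\
  exists2 d, lm_direction F DF (nu k) (z k) d & z k.+1 = z k + d.

(* In a terminating run, the values of z beyond the last iterate z K are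
   irrelevant. *)
Definition lm_terminates (R : realType) (p q : nat)
    (F : 'cV[R]_p -> 'cV[R]_q) (DF : 'cV[R]_p -> 'M[R]_(q, p))
    (stop : nat -> 'cV[R]_p -> Prop) (nu : nat -> R)
    (z0 : 'cV[R]_p) : Prop :=
  exists (K : nat) (z : nat -> 'cV[R]_p),
    [/\ z 0%N = z0, forall k, (k < K)%N -> lm_iteration F DF stop nu z k &
        stop K (z K)].

Definition lm_produces (R : realType) (p q : nat)
    (F : 'cV[R]_p -> 'cV[R]_q) (DF : 'cV[R]_p -> 'M[R]_(q, p))
    (stop : nat -> 'cV[R]_p -> Prop) (nu : nat -> R)
    (z0 : 'cV[R]_p) (z : nat -> 'cV[R]_p) : Prop :=
  z 0%N = z0 /\ forall k, lm_iteration F DF stop nu z k.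

Definition converges_superlinearly (R : realType) (p : nat)
    (z : nat -> 'cV[R]_p) (zbar : 'cV[R]_p) : Prop :=
  z @ \oo --> zbar /\
  (fun k => enorm (z k.+1 - zbar)) =o_\oo (fun k => enorm (z k - zbar)).

Definition converges_quadratically (R : realType) (p : nat)
    (z : nat -> 'cV[R]_p) (zbar : 'cV[R]_p) : Prop :=
  z @ \oo --> zbar /\
  (fun k => enorm (z k.+1 - zbar)) =O_\oo (fun k => enorm (z k - zbar) ^+ 2).

(* Main.v *)
(* With A = DF z, e = z - zbar and r = newton_remainder F DF zbar e, the new
   iterate z' solves (A^T A + nu I)(z' - zbar) = nu e - A^T r. Testing with
   z' - zbar and using x^T A^T A x >= |x|^2 / C gives
     |z' - zbar| <= C nu |e| + C^2 |r|.
   Since r is o(|e|), the error is at least halved in every step once z^0 is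
   close to zbar and nu is small, and nu -> 0 makes the convergence superlinear.
   In the second case nu_k = O(|F(z^k)|) = O(|e|) by calmness, and
   r = O(|e|^2). *)
Require Import Defs.
From mathcomp Require Import all_boot all_order all_algebra.
From mathcomp Require Import all_classical all_reals all_analysis.
From mathcomp Require Import ring lra.
Import Order.TTheory GRing.Theory Num.Theory.
Import numFieldNormedType.Exports.
Local Open Scope classical_set_scope.
Local Open Scope ring_scope.

(** * Inner product, positive semidefinite forms and the smallest eigenvalue *)

Definition dot {R : realType} {n : nat} (x y : 'cV[R]_n) : R :=
  \sum_(i < n) x i 0 * y i 0.

Lemma dotC {R : realType} {n} (x y : 'cV[R]_n) : dot x y = dot y x.
Proof. by apply: eq_bigr => i _; rewrite mulrC. Qed.

Lemma dotDl {R : realType} {n} (x y z : 'cV[R]_n) :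
  dot (x + y) z = dot x z + dot y z.
Proof. by rewrite -big_split; apply: eq_bigr => i _; rewrite mxE mulrDl. Qed.

Lemma dotZl {R : realType} {n} (a : R) (x z : 'cV[R]_n) :
  dot (a *: x) z = a * dot x z.
Proof. by rewrite mulr_sumr; apply: eq_bigr => i _; rewrite mxE mulrA. Qed.

Lemma dotDr {R : realType} {n} (x y z : 'cV[R]_n) :
  dot z (x + y) = dot z x + dot z y.
Proof. by rewrite dotC dotDl ![dot z _]dotC. Qed.

Lemma dotZr {R : realType} {n} (a : R) (x z : 'cV[R]_n) :
  dot z (a *: x) = a * dot z x.
Proof. by rewrite dotC dotZl dotC. Qed.

Lemma dot_trmx {R : realType} {m n} (A : 'M[R]_(m, n)) x y :
  dot (A *m x) y = dot x (A^T *m y).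
Proof.
have dotE k (u v : 'cV[R]_k) : dot u v = (u^T *m v) 0 0.
  by rewrite mxE; apply: eq_bigr => i _; rewrite mxE.
by rewrite !dotE trmx_mul mulmxA.
Qed.

Lemma dot_ge0 {R : realType} {n} (x : 'cV[R]_n) : 0 <= dot x x.
Proof. by apply: sumr_ge0 => i _; rewrite -expr2 sqr_ge0. Qed.

Lemma dot_eq0 {R : realType} {n} (x : 'cV[R]_n) : dot x x = 0 -> x = 0.
Proof.
move/psumr_eq0P => h; apply/colP => i; rewrite mxE; apply/eqP.
by rewrite -sqrf_eq0 expr2 h // => j _; rewrite -expr2 sqr_ge0.
Qed.

(* The discriminant argument, also for a degenerate form. *)
Lemma psd_cauchy_schwarz {R : realType} {n} (B : 'M[R]_n) (x y : 'cV[R]_n) :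
  B^T = B -> (forall v, 0 <= dot v (B *m v)) ->
  dot x (B *m y) ^+ 2 <= dot x (B *m x) * dot y (B *m y).
Proof.
move=> Bsym Bge0.
have yx : dot y (B *m x) = dot x (B *m y).
  by rewrite dotC dot_trmx Bsym.
have quad s t : 0 <= s ^+ 2 * dot x (B *m x) + 2 * s * t * dot x (B *m y)
                    + t ^+ 2 * dot y (B *m y).
  have := Bge0 (s *: x + t *: y).
  rewrite mulmxDr -!scalemxAr dotDl !dotDr !dotZl !dotZr yx.
  by move/le_trans; apply; rewrite le_eqVlt; apply/orP; left; apply/eqP; ring.
move: quad (Bge0 x) (Bge0 y).
move: (dot x (B *m x)) (dot x (B *m y)) (dot y (B *m y)) => a b c quad a0.
rewrite le_eqVlt => /predU1P[c0|c0].
  rewrite -{}c0 in quad *.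
  case: (eqVneq b 0) => [->|b0]; first by rewrite expr0n /= mulr0.
  (* With [c = 0] the form is affine in [t]; this choice of [t] gives it the value [- a - 2 < 0], so
     [b] must vanish. *)
  have := quad 1 (- (a + 1) / b).
  have -> : 2 * 1 * (- (a + 1) / b) * b = - 2 * (a + 1) by field.
  by rewrite mulr0 addr0 expr1n mul1r; lra.
(* The minimizing ratio of [s] and [t], scaled by [c] to avoid a division. *)
have := quad c (- b).
have -> : c ^+ 2 * a + 2 * c * (- b) * b + (- b) ^+ 2 * c
  = c * (a * c - b ^+ 2) by ring.
by rewrite pmulr_rge0 // subr_ge0.
Qed.

Lemma cauchy_schwarz {R : realType} {n} (x y : 'cV[R]_n) :
  dot x y ^+ 2 <= dot x x * dot y y.
Proof.
have := @psd_cauchy_schwarz R n 1%:M x y (trmx1 _ _).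
by rewrite !mul1mx; apply=> v; rewrite mul1mx dot_ge0.
Qed.

(** Cauchy-Schwarz on each row bounds the quotient by the squared Frobenius norm; adding 1 makes the
    constant positive. *)
Lemma mulmx_dot_bounded {R : realType} {m n} (A : 'M[R]_(m, n)) :
  exists2 K, 0 < K & forall x, dot (A *m x) (A *m x) <= K * dot x x.
Proof.
pose S := \sum_(i < m) dot (row i A)^T (row i A)^T.
have S0 : 0 <= S by apply: sumr_ge0 => i _; exact: dot_ge0.
exists (S + 1); first by lra.
move=> x; apply: (@le_trans _ _ (S * dot x x)); last first.
  by rewrite ler_wpM2r ?dot_ge0 // lerDl ler01.
rewrite {1}/dot mulr_suml; apply: ler_sum => i _.
rewrite -expr2 (_ : (A *m x) i 0 = dot (row i A)^T x) ?cauchy_schwarz //.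
by rewrite mxE; apply: eq_bigr => j _; rewrite !mxE.
Qed.

(** Cauchy-Schwarz for the form of [B] at [x] and [B x] gives [|B x|^4 <= (x^T B x) (K |B x|^2)],
    hence [|B x|^2 <= K x^T B x]. Boundedness of the inverse gives [|x|^2 <= L |B x|^2]. *)
Lemma psd_unit_coercive {R : realType} {n} (B : 'M[R]_n) :
  B^T = B -> (forall v, 0 <= dot v (B *m v)) -> B \in unitmx ->
  exists2 m, 0 < m & forall x, m * dot x x <= dot x (B *m x).
Proof.
move=> Bsym Bge0 Bu.
have [K1 K10 hK] := mulmx_dot_bounded B.
pose K := K1 + 1; have K0 : 0 < K by rewrite addr_gt0.
have [L L0 hL] := mulmx_dot_bounded (invmx B).
exists (K * L)^-1 => [|x]; first by rewrite invr_gt0 mulr_gt0.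
have hx : dot x x <= L * dot (B *m x) (B *m x).
  by have := hL (B *m x); rewrite mulKmx.
have hB : dot (B *m x) (B *m x) <= K * dot x (B *m x).
  have [->|N0] := eqVneq (dot (B *m x) (B *m x)) 0.
    exact: mulr_ge0 (ltW K0) (Bge0 x).
  have Np : 0 < dot (B *m x) (B *m x) by rewrite lt_neqAle eq_sym N0 dot_ge0.
  have h1 := psd_cauchy_schwarz B x (B *m x) Bsym Bge0.
  have h2 := cauchy_schwarz (B *m x) (B *m (B *m x)).
  have h3 := hK (B *m x).
  have e1 : dot x (B *m (B *m x)) = dot (B *m x) (B *m x).
    by rewrite dot_trmx Bsym.
  rewrite e1 in h1; have h0 := Bge0 x; have h4 := Bge0 (B *m x).
  move: h0 h1 h2 h3 h4 Np K0.
  move: (dot x (B *m x)) (dot (B *m x) (B *m x)).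
  move: (dot (B *m x) (B *m (B *m x))).
  move: (dot (B *m (B *m x)) (B *m (B *m x))).
  move=> d c a b a0 h1 h2 h3 c0 b0 K0.
  (* The two bounds give [c^2 <= K1 b^2]; since [K1 <= (K1 + 1)^2], taking [K = K1 + 1] avoids a
     square root. *)
  have hc : c <= K * b.
    rewrite -ler_sqr ?nnegrE ?(mulr_ge0 (ltW K0) (ltW b0)) //.
    apply: (le_trans h2); apply: (le_trans (ler_wpM2l (ltW b0) h3)).
    have : 0 <= b ^+ 2 * (K1 ^+ 2 + K1 + 1) by rewrite mulr_ge0 ?sqr_ge0 //; nra.
    by rewrite /K; nra.
  rewrite -(ler_pM2r b0) -expr2 (le_trans h1) // [leRHS]mulrAC mulrC.
  by rewrite ler_wpM2r.
rewrite ler_pdivrMl ?mulr_gt0 // [K * L]mulrC -mulrA (le_trans hx) //.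
by rewrite ler_wpM2l // ltW.
Qed.

(* The largest [t] with [t |x|^2 <= x^T N x] is an eigenvalue, since otherwise
   [N - t I] would be coercive. *)
Lemma lambda_min_le {R : realType} {n} (N : 'M[R]_n) (x : 'cV[R]_n) :
  N^T = N -> (forall v, 0 <= dot v (N *m v)) ->
  lambda_min N * dot x x <= dot x (N *m x).
Proof.
move=> Nsym Nge0.
have [x0|xN0] := eqVneq (dot x x) 0; first by rewrite x0 mulr0 Nge0.
have xp : 0 < dot x x by rewrite lt_neqAle eq_sym xN0 dot_ge0.
pose S := [set t | forall v, t * dot v v <= dot v (N *m v)].
have S0 : S 0 by move=> v /=; rewrite mul0r.
have Sub : has_ubound S.
  by exists (dot x (N *m x) / dot x x) => t /(_ x); rewrite ler_pdivlMr.
(* The supremum is attained: for nonzero [v] the condition bounds [t] by the Rayleigh quotient of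
   [v], which then bounds [sup S] too. *)
have supS : S (sup S).
  move=> v; have [v0|vN0] := eqVneq (dot v v) 0; first by rewrite v0 mulr0.
  have vp : 0 < dot v v by rewrite lt_neqAle eq_sym vN0 dot_ge0.
  rewrite -ler_pdivlMr //; apply: ge_sup; first by exists 0.
  by move=> t /(_ v); rewrite ler_pdivlMr.
have BE v : (N - (sup S)%:M) *m v = N *m v + (- sup S) *: v.
  by rewrite mulmxBl mul_scalar_mx scaleNr.
have eigS : eigenvalue N (sup S).
  apply/eqP => /eqP; rewrite kermx_eq0 row_free_unit => Bu.
  have [| |m m0 hm] := @psd_unit_coercive R n (N - (sup S)%:M) _ _ Bu.
  - by rewrite linearB /= Nsym tr_scalar_mx.
  - by move=> v; rewrite BE dotDr dotZr mulNr subr_ge0; exact: supS.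
  have : S (sup S + m).
    move=> v /=; have := hm v; rewrite BE dotDr dotZr; lra.
  by move/(ub_le_sup Sub); rewrite gerDl leNgt m0.
apply: le_trans (supS x); rewrite ler_pM2r //.
(* The infimum is a lower bound only for a set bounded below. Here 0 works: by symmetry a row
   eigenvector transposes to a column one, and its Rayleigh quotient is nonnegative. *)
apply: ge_inf => //; exists 0 => a /eigenvalueP[v vN v0].
have vp : 0 < dot v^T v^T.
  rewrite lt_neqAle dot_ge0 andbT eq_sym; apply: contra_neq v0 => /dot_eq0 h.
  by rewrite -[v]trmxK h trmx0.
rewrite -(pmulr_lge0 _ vp) -dotZr -linearZ /= -vN trmx_mul Nsym.
exact: Nge0.
Qed.

(** * Euclidean and spectral norms *)

Lemma enorm_ge0 {R : realType} {n} (x : 'cV[R]_n) : 0 <= enorm x.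
Proof. exact: sqrtr_ge0. Qed.

Lemma sqr_enorm {R : realType} {n} (x : 'cV[R]_n) : enorm x ^+ 2 = dot x x.
Proof.
rewrite sqr_sqrtr; last by apply: sumr_ge0 => i _; rewrite sqr_ge0.
by apply: eq_bigr => i _; rewrite expr2.
Qed.

Lemma enorm0 {R : realType} {n} : enorm (0 : 'cV[R]_n) = 0.
Proof. by rewrite /enorm big1 ?sqrtr0 // => i _; rewrite mxE expr0n. Qed.

Lemma enorm_eq0 {R : realType} {n} (x : 'cV[R]_n) : enorm x = 0 -> x = 0.
Proof. by move=> x0; apply: dot_eq0; rewrite -sqr_enorm x0 expr0n. Qed.

Lemma enormZ {R : realType} {n} (a : R) (x : 'cV[R]_n) :
  enorm (a *: x) = `|a| * enorm x.
Proof.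
rewrite /enorm -sqrtr_sqr -sqrtrM ?sqr_ge0 // mulr_sumr.
by congr (Num.sqrt _); apply: eq_bigr => i _; rewrite mxE exprMn.
Qed.

Lemma normr_dot_le {R : realType} {n} (x y : 'cV[R]_n) :
  `|dot x y| <= enorm x * enorm y.
Proof.
rewrite -ler_sqr ?nnegrE ?mulr_ge0 ?enorm_ge0 //.
by rewrite exprMn !sqr_enorm real_normK ?num_real // cauchy_schwarz.
Qed.

Lemma normr_le_enorm {R : realType} {n} (x : 'cV[R]_n) : `|x| <= enorm x.
Proof.
rewrite /Num.norm /= mx_normrE; apply/bigmax_leP; split=> [|[i j] _ /=].
  exact: enorm_ge0.
rewrite (ord1 j) -sqrtr_sqr ler_sqrt ?sumr_ge0 //; last first.
  by move=> k _; rewrite sqr_ge0.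
by rewrite (bigD1 i) //= lerDl sumr_ge0 // => k _; rewrite sqr_ge0.
Qed.

(** Turns library neighbourhoods, built on open maximum-norm balls, into closed Euclidean balls;
    halving the radius makes the inequality strict. *)
Lemma near0_enorm {R : realType} {n} (P : 'cV[R]_n -> Prop) :
  (\forall x \near (0 : 'cV[R]_n), P x) ->
  exists2 e, 0 < e & forall x, enorm x <= e -> P x.
Proof.
move/nbhs_norm0P => [e /= e0 he]; exists (e / 2); first by rewrite divr_gt0.
move=> x xe; apply: he => /=; apply: (le_lt_trans (normr_le_enorm x)).
by apply: (le_lt_trans xe); lra.
Qed.

Lemma enorm_mulmx_le {R : realType} {m n} (A : 'M[R]_(m, n)) x :
  enorm (A *m x) <= spectral_norm A * enorm x.
Proof.
have [x0|xN0] := eqVneq (enorm x) 0.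
  by rewrite x0 mulr0 (enorm_eq0 _ x0) mulmx0 enorm0.
have xp : 0 < enorm x by rewrite lt_neqAle eq_sym xN0 enorm_ge0.
rewrite -ler_pdivrMr // mulrC -[X in X * _]ger0_norm ?invr_ge0 ?enorm_ge0 //.
rewrite -enormZ scalemxAr; apply: ub_le_sup.
  (* The normalized vector [x / |x|] yields a member of the set under [sup]; it lies below [sup]
     once the set is known to be bounded above. *)
  have [K K0 hK] := mulmx_dot_bounded A.
  exists (Num.sqrt K) => _ [y /= y1 <-].
  rewrite -ler_sqr ?nnegrE ?enorm_ge0 ?sqrtr_ge0 // [Num.sqrt K ^+ 2]sqr_sqrtr ?(ltW K0) //.
  rewrite sqr_enorm; apply: (le_trans (hK y)).
  by rewrite -sqr_enorm ler_piMr ?expr_le1 ?enorm_ge0 // ltW.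
by eexists=> //=; rewrite enormZ ger0_norm ?invr_ge0 ?enorm_ge0 // mulVf.
Qed.

(** * The regularized Gram matrix *)

Lemma dot_gram_ge0 {R : realType} {m n} (A : 'M[R]_(m, n)) v :
  0 <= dot v (A^T *m A *m v).
Proof. by rewrite -mulmxA -dot_trmx dot_ge0. Qed.

(** A kernel vector [v] satisfies [|A v|^2 + nu |v|^2 = 0], so it is zero. *)
Lemma regularized_gram_unit {R : realType} {m n} (A : 'M[R]_(m, n)) nu :
  0 < nu -> A^T *m A + nu%:M \in unitmx.
Proof.
move=> nu0; rewrite -unitmx_tr -row_free_unit -kermx_eq0.
apply: contraT => /rowV0Pn[v /sub_kermxP vB v0].
have : (A^T *m A + nu%:M) *m v^T = 0 by rewrite -[LHS]trmxK trmx_mul trmxK vB trmx0.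
rewrite mulmxDl mul_scalar_mx => /(congr1 (dot v^T)).
rewrite dotDr dotZr => h.
have z0 : dot v^T 0 = 0 by rewrite -(scale0r 0) dotZr mul0r.
have h1 := dot_gram_ge0 A v^T; have h2 := dot_ge0 v^T.
have /dot_eq0 vt0 : dot v^T v^T = 0 by nra.
by rewrite -[v]trmxK vt0 trmx0 eqxx in v0.
Qed.

Lemma regularized_step_bound {R : realType} {m n} (A : 'M[R]_(m, n))
    (C nu : R) (e y : 'cV[R]_n) (r : 'cV[R]_m) :
  0 < C -> 0 < nu -> C^-1 <= lambda_min (A^T *m A) -> spectral_norm A <= C ->
  (A^T *m A + nu%:M) *m y = nu *: e - A^T *m r ->
  enorm y <= C * nu * enorm e + C ^+ 2 * enorm r.
Proof.
move=> C0 nu0 hl hs eqy.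
have [y0|yN0] := eqVneq (enorm y) 0.
  by rewrite y0 addr_ge0 ?mulr_ge0 ?sqr_ge0 ?enorm_ge0 ?ltW.
have yp : 0 < enorm y by rewrite lt_neqAle eq_sym yN0 enorm_ge0.
have hN : C^-1 * enorm y ^+ 2 <= dot y (A^T *m A *m y).
  rewrite sqr_enorm; apply: le_trans (lambda_min_le _ _ _ (dot_gram_ge0 A)).
    by rewrite ler_wpM2r ?dot_ge0.
  by rewrite trmx_mul trmxK.
have : dot y (A^T *m A *m y) + nu * enorm y ^+ 2 = nu * dot y e - dot (A *m y) r.
  have := congr1 (dot y) eqy.
  by rewrite mulmxDl mul_scalar_mx !dotDr !dotZr -scaleN1r dotZr mulN1r
    -dot_trmx sqr_enorm.
have he : nu * dot y e <= nu * (enorm y * enorm e).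
  by rewrite ler_wpM2l ?(ltW nu0) // (le_trans (ler_norm _)) // normr_dot_le.
have hr : - dot (A *m y) r <= C * enorm y * enorm r.
  apply: (le_trans (ler_norm _)); rewrite normrN.
  apply: (le_trans (normr_dot_le _ _)); rewrite ler_wpM2r ?enorm_ge0 //.
  by apply: (le_trans (enorm_mulmx_le _ _)); rewrite ler_wpM2r ?enorm_ge0.
move=> hy.
(* The nonnegative term [nu |y|^2] is dropped; what remains has the factor [|y|] on both sides. *)
have : C^-1 * enorm y * enorm y <= (nu * enorm e + C * enorm r) * enorm y.
  by have := mulr_ge0 (ltW nu0) (sqr_ge0 (enorm y)); nra.
rewrite ler_pM2r // ler_pdivrMl // => /le_trans; apply.
by rewrite le_eqVlt; apply/orP; left; apply/eqP; ring.
Qed.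

(** * The iteration and its one-step error bound *)

Definition lm_dir {R : realType} {p q} (F : 'cV[R]_p -> 'cV[R]_q)
    (DF : 'cV[R]_p -> 'M[R]_(q, p)) (nu : R) (z : 'cV[R]_p) : 'cV[R]_p :=
  invmx ((DF z)^T *m DF z + nu%:M) *m - ((DF z)^T *m F z).

(** The run that ignores the termination criterion; any actual run is an initial segment of it or
    all of it. *)
Fixpoint lm_seq {R : realType} {p q} (F : 'cV[R]_p -> 'cV[R]_q)
    (DF : 'cV[R]_p -> 'M[R]_(q, p)) (nu : nat -> R) (z0 : 'cV[R]_p) (k : nat) :
    'cV[R]_p :=
  if k is k'.+1 then
    lm_seq F DF nu z0 k' + lm_dir F DF (nu k') (lm_seq F DF nu z0 k')
  else z0.

(** [invmx] returns a singular matrix unchanged, so positivity of [nu] is what makes [lm_dir] solve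
    the equation. *)
Lemma lm_direction_dir {R : realType} {p q} (F : 'cV[R]_p -> 'cV[R]_q)
    (DF : 'cV[R]_p -> 'M[R]_(q, p)) nu z :
  0 < nu -> lm_direction F DF nu z (lm_dir F DF nu z).
Proof.
move=> /(regularized_gram_unit (DF z)) Bu.
by rewrite /lm_dir; split=> [|d <-]; rewrite ?mulKVmx ?mulKmx.
Qed.

Lemma lm_step_bound {R : realType} {p q} (F : 'cV[R]_p -> 'cV[R]_q)
    (DF : 'cV[R]_p -> 'M[R]_(q, p)) (zbar z : 'cV[R]_p) (C nu : R) :
  F zbar = 0 -> 0 < C -> 0 < nu ->
  C^-1 <= lambda_min ((DF z)^T *m DF z) -> spectral_norm (DF z) <= C ->
  enorm (z + lm_dir F DF nu z - zbar) <= C * nu * enorm (z - zbar)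
     + C ^+ 2 * enorm (newton_remainder F DF zbar (z - zbar)).
Proof.
move=> F0 C0 nu0 hl hs; apply: (regularized_step_bound _ _ _ _ _ _ C0 nu0 hl hs).
have [/= hd _] := lm_direction_dir F DF nu z nu0.
(* Since [F zbar = 0], the remainder is [F z - A e] with [A = DF z] and [e = z - zbar]; this cancels
   [A^T A e]. *)
rewrite addrAC mulmxDr hd /newton_remainder F0 subr0 [zbar + _]addrC subrK.
rewrite mulmxDl mul_scalar_mx [in RHS]mulmxBr !mulmxA.
by rewrite opprB [RHS]addrA [nu *: _ + _]addrC.
Qed.

(* The first index at which the termination criterion holds, if any, ends the
   run. *)
Lemma lm_terminates_or_produces {R : realType} {p q} (F : 'cV[R]_p -> 'cV[R]_q)
    (DF : 'cV[R]_p -> 'M[R]_(q, p)) (stop : nat -> 'cV[R]_p -> Prop)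
    (nu : nat -> R) z0 :
  (forall k, 0 < nu k) ->
  lm_terminates F DF stop nu z0 \/
  lm_produces F DF stop nu z0 (lm_seq F DF nu z0).
Proof.
move=> nu0; set z := lm_seq F DF nu z0.
have step k : ~ stop k (z k) -> lm_iteration F DF stop nu z k.
  by move=> Nstop; split=> //; eexists; first exact: lm_direction_dir.
have [hstop|Nstop] := pselect (exists k, `[< stop k (z k) >]); last first.
  right; split=> // k; apply: step => sk; apply: Nstop.
  by exists k; apply/asboolP.
left; have [K /asboolP stopK minK] := ex_minnP hstop.
exists K, z; split=> // k kK; apply: step => /asboolP /minK.
by rewrite leqNgt kK.
Qed.

Theorem theorem3p2 (R : realType) (p q : nat) (hpq : (p < q)%N)
    (F : 'cV[R]_p -> 'cV[R]_q) (DF : 'cV[R]_p -> 'M[R]_(q, p))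
    (M : set 'cV[R]_p) (zbar : 'cV[R]_p)
    (hzbar : F zbar = 0) (hM : M zbar)
    (hND : newton_differentiable F DF M)
    (hreg : exists delta C : R, [/\ 0 < delta, 0 < C &
       forall z, eball zbar delta z ->
         [/\ \rank (DF z) = p,
             C^-1 <= lambda_min ((DF z)^T *m DF z) &
             spectral_norm (DF z) <= C]]) :
  exists eps : R, 0 < eps /\
    forall (z0 : 'cV[R]_p) (nu : nat -> R) (stop : nat -> 'cV[R]_p -> Prop),
      eball zbar eps z0 ->
      (forall k, 0 < nu k < eps) ->
      nu @ \oo --> (0 : R) ->
      lm_terminates F DF stop nu z0 \/
      exists z : nat -> 'cV[R]_p,
        [/\ lm_produces F DF stop nu z0 z,
            converges_superlinearly z zbar &
            newton_differentiable_order 1 F DF M ->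
            nu =O_\oo (fun k => enorm (F (z k))) ->
            calm_at F zbar ->
            converges_quadratically z zbar].
Proof.
have [delta [C [delta0 C0 reg]]] := hreg.
have C20 : 0 < C ^+ 2 by rewrite exprn_gt0.
have ND c : 0 < c -> exists2 rho, 0 < rho & forall d, enorm d <= rho ->
    enorm (newton_remainder F DF zbar d) <= c * enorm d.
  move=> c0; have /eqoP/(_ c c0)/near0_enorm[rho rho0 h] := hND zbar hM.
  by exists rho => // d /h /=; rewrite !ger0_norm ?enorm_ge0.
have [|rho rho0 hrho] := ND (4 * C ^+ 2)^-1.
  by rewrite invr_gt0 mulr_gt0.
(* [delta] gives the regularity bounds, [rho] gives [C^2 |r| <= |e| / 4], and [nu < (4 C)^-1] gives
   [C nu <= 1/4]: together the error is halved. *)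
pose eps := Num.min delta (Num.min rho (4 * C)^-1).
have eps0 : 0 < eps by rewrite !lt_min delta0 rho0 invr_gt0 mulr_gt0.
exists eps; split=> // z0 nu stop z0eps nueps nu_cvg.
have nu0 k : 0 < nu k by have /andP[] := nueps k.
have [|prod] := lm_terminates_or_produces F DF stop nu z0 nu0; first by left.
right; exists (lm_seq F DF nu z0); move: prod.
set z := lm_seq F DF nu z0 => prod.
pose e k := enorm (z k - zbar); pose r k := newton_remainder F DF zbar (z k - zbar).
have e_ge0 k : 0 <= e k by exact: enorm_ge0.
have step k : e k <= eps -> e k.+1 <= C * nu k * e k + C ^+ 2 * enorm (r k).
  rewrite !le_min => /andP[ed _]; have [_ hl hs] := reg _ ed.
  exact: lm_step_bound.
have half k : e k <= eps -> e k.+1 <= 2^-1 * e k.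
  move=> ek; have := ek; rewrite !le_min => /and3P[_ er _].
  apply: (le_trans (step k ek)).
  have -> : 2^-1 * e k = 4^-1 * e k + 4^-1 * e k by field.
  apply: lerD.
    rewrite ler_wpM2r //; have /andP[_] := nueps k.
    rewrite !lt_min => /and3P[_ _ /ltW].
    by rewrite invfM mulrC ler_pdivlMl.
  have := hrho _ er; rewrite -[leLHS]/(enorm (r k)) => hr.
  by rewrite -ler_pdivlMl // mulrA -invfM [_ * 4]mulrC.
(* One induction yields both the decay and the fact that no iterate leaves the ball on which [step]
   holds. *)
have e_le k : e k <= 2^-1 ^+ k * eps.
  elim: k => [|k IH]; first by rewrite mul1r.
  have ek : e k <= eps.
    apply: (le_trans IH); rewrite ler_piMl ?(ltW eps0) // exprn_ile1 //; lra.
  apply: (le_trans (half k ek)).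
  by rewrite exprS -mulrA ler_pM2l // invr_gt0.
have e_eps k : e k <= eps.
  by apply: (le_trans (e_le k)); rewrite ler_piMl ?(ltW eps0) // exprn_ile1 //; lra.
have e_cvg : e @ \oo --> (0 : R).
  apply: (@squeeze_cvgr _ _ _ _ (fun=> 0) (fun k => 2^-1 ^+ k * eps)).
  - by near=> k; rewrite e_ge0 e_le.
  - exact: cvg_cst.
  - rewrite -[X in _ --> X](mul0r eps); apply: cvgMr_tmp; apply: cvg_expr.
    by rewrite ger0_norm; lra.
have e_near c : 0 < c -> \forall k \near \oo, e k <= c.
  move=> c0; near=> k; rewrite -[e k]ger0_norm //.
  by near: k; exact: cvgr0_norm_le.
have z_cvg : z @ \oo --> zbar.
  apply/cvgrPdist_le => c /e_near ec; near=> k.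
  rewrite distrC (le_trans (normr_le_enorm _)) // -/(e k).
  by near: k; exact: ec.
split=> // [|NDO nuO [L [c [L0 c0 calm]]]]; split=> //.
  apply/eqoP => c c0.
  (* Each term of the step bound gets half of [c]: the remainder through this constant, the other
     through [nu k <= c / 2 / C] eventually. *)
  have [|s s0 hs] := ND (c / 2 / C ^+ 2); first by rewrite !divr_gt0.
  near=> k; rewrite !ger0_norm -/(e k) -/(e k.+1) ?e_ge0 //.
  apply: (le_trans (step k (e_eps k))).
  have -> : c * e k = c / 2 * e k + c / 2 * e k by field.
  apply: lerD.
    rewrite ler_wpM2r // -ler_pdivlMl // mulrC -[nu k]ger0_norm ?(ltW (nu0 k)) //.
    by near: k; apply: cvgr0_norm_le => //; rewrite !divr_gt0.
  rewrite -ler_pdivlMl // mulrA [_^-1 * _]mulrC; apply: hs.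
  by near: k; exact: e_near.
have /eqO_exP[K1 K10 /near0_enorm[s s0 hs]] := NDO zbar hM.
have /eqO_exP[K2 K20 hK2] := nuO.
(* The first summand comes from [nu k <= K2 |F (z k)| <= K2 L e k], the second from
   [|r k| <= K1 (e k)^2]. *)
apply/eqO_exP; exists (C * (K2 * L) + C ^+ 2 * K1).
  by rewrite addr_gt0 ?mulr_gt0.
near=> k; rewrite !ger0_norm -/(e k) -/(e k.+1) ?e_ge0 ?sqr_ge0 //.
apply: (le_trans (step k (e_eps k))); rewrite mulrDl; apply: lerD.
  rewrite -2!mulrA ler_pM2l // expr2 mulrA ler_wpM2r //.
  have nuk : nu k <= K2 * enorm (F (z k)).
    rewrite -[nu k]ger0_norm ?(ltW (nu0 k)) // -[enorm _]ger0_norm ?enorm_ge0 //.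
    by near: k; exact: hK2.
  have Fk : enorm (F (z k)) <= L * e k.
    rewrite -[F (z k)]subr0 -hzbar; apply: calm.
    by near: k; exact: e_near.
  by rewrite -mulrA (le_trans nuk) // ler_pM2l.
rewrite -[leRHS]mulrA ler_pM2l //.
have ks : e k <= s by near: k; exact: e_near.
have := hs _ ks; rewrite /= !ger0_norm ?enorm_ge0 ?powR_ge0 //.
(* The real power with exponent [1 + alpha] becomes an ordinary square at [alpha = 1]. *)
by rewrite (_ : 1 + 1 = 2%:R) // powR_mulrn ?enorm_ge0.
Unshelve. all: by end_near.
Qed.
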